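(* Let $n \geq 1$. Then $\mathrm{PF}_n = \mathrm{CPF}_n(k)$ for all integers $k \geq 0$.
   Context: There are $n$ cars, numbered $1,\dots,n$, entering in this order a one-way street with parking spots $1,2,\dots,n$ (in this order along the street). A preference tuple is $\alpha=(a_1,\dots,a_n)\in[n]^n$, where $[n]=\{1,\dots,n\}$ and $a_i$ is the preferred spot of car $i$. Classical parking rule: car $i$ parks in the first available spot $j\ge a_i$, if any. $\alpha$ is a parking function of length $n$ if all cars can park; $\mathrm{PF}_n$ is the set of parking functions of length $n$. $k$-cascading parking rule ($k\ge 0$ an integer): when car $i$ enters, if spot $a_i$ is available it parks there. If spot $a_i$ is occupied and $k\geq 1$, car $i$ parks in spot $a_i$ and bumps the car occupying it out of it; the bumped car attempts to park in the spot immediately after the one it was bumped from: if that spot is available it parks there; if it is occupied and fewer than $k$ bumps have occurred since the arrival of car $i$, it parks there and bumps the car occupying it, which then attempts to park in the next spot in the same way, and so on. Once $k$ bumps have occurred, the last displaced car continues down the street without bumping any more cars and parks in the first unoccupied spot it encounters, if any. A car that runs past spot $n$ fails to park. For $k=0$ no bumping occurs and a car finding its preferred spot occupied continues forward to the first available spot. $\alpha$ is a $k$-cascading parking function if all cars can park under this rule; $\mathrm{CPF}_n(k)$ is the set of $k$-cascading parking functions of length $n$. *)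

(* Defs.v *)
From mathcomp Require Import all_boot.

Set Implicit Arguments.
Unset Strict Implicit.
Unset Printing Implicit Defensive.

(* Cars and spots 1, ..., n are both encoded as 0, ..., n-1 : 'I_n.
   In a configuration, [c s] is [Some i] when car i stands in spot s, and
   [None] when spot s is available. *)
Definition config (n : nat) : Type := {ffun 'I_n -> option 'I_n}.

Definition empty_street (n : nat) : config n := [ffun=> None].

Definition put (n : nat) (c : config n) (s i : 'I_n) : config n :=
  [ffun t => if t == s then Some i else c t].

Definition first_available (n : nat) (c : config n) (j : nat) : option 'I_n :=
  [pick s : 'I_n | [&& j <= s, c s == None
                     & [forall t : 'I_n, (j <= t < s) ==> (c t != None)]]].

(* A car that runs past the last spot leaves the street for good: the
   configuration returned does not contain it. *)
Definition drive (n : nat) (c : config n) (i : 'I_n) (j : nat) : config n :=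
  if first_available c j is Some s then put c s i else c.

(* Car i attempts to park in spot j while b more bumps are allowed. The position
   j is a natural number since a car bumped out of the last spot moves on to
   position n, which is not a spot. *)
Fixpoint cascade (n b : nat) (c : config n) (i : 'I_n) (j : nat) : config n :=
  if insub j is Some s then
    if c s is Some d then
      if b is b'.+1 then cascade b' (put c s i) d j.+1
      else drive c i j
    else put c s i
  else c.

(* [rule c i a] is the configuration after car i, preferring spot a, has entered
   the street in configuration c. *)
Definition outcome (n : nat) (rule : config n -> 'I_n -> 'I_n -> config n)
    (alpha : n.-tuple 'I_n) : config n :=
  foldl (fun c i => rule c i (tnth alpha i)) (empty_street n) (enum 'I_n).

Definition all_parked (n : nat) (c : config n) : bool :=
  [forall i : 'I_n, exists s : 'I_n, c s == Some i].

Definition classical_rule (n : nat) (c : config n) (i a : 'I_n) : config n :=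
  drive c i a.

Definition cascading_rule (n k : nat) (c : config n) (i a : 'I_n) : config n :=
  cascade k c i a.

Definition PF (n : nat) : {set n.-tuple 'I_n} :=
  [set alpha | all_parked (outcome (@classical_rule n) alpha)].

Definition CPF (n k : nat) : {set n.-tuple 'I_n} :=
  [set alpha | all_parked (outcome (@cascading_rule n k) alpha)].

(* Main.v *)
Require Import Defs.
From mathcomp Require Import all_boot.

(** The number k of allowed bumps decides which car stands where, but not which
    spots are taken. Indeed a bump leaves the set of occupied spots unchanged
    and turns the problem of parking some car from spot j on into that of
    parking another car from spot j + 1 on, where spot j is occupied; so under
    every rule an arrival with preference a adds to the occupied set exactly its
    first missing spot from a on, if there is one ([occupied_cascade]). Hence
    the final occupied set is a function of the preferences alone
    ([occupied_outcome]).

    It remains to read off from the occupied set whether all cars have parked.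
    There are as many cars as spots and no car ever stands in two spots
    ([single_outcome]), so all cars are parked exactly when all spots are
    occupied ([all_parked_full]). The classical rule is the cascading rule with
    k = 0 ([cascade0]), and so one theorem about cascades covers both sides. *)

Set Implicit Arguments.
Unset Strict Implicit.
Unset Printing Implicit Defensive.

Section Street.

Variable n : nat.
Implicit Types (c : config n) (i s t a : 'I_n) (O : {set 'I_n}).

Definition occupied c : {set 'I_n} := [set s | c s != None].

Definition first_missing O (j : nat) : option 'I_n :=
  [pick s : 'I_n | [&& j <= s, s \notin O
                     & [forall t : 'I_n, (j <= t < s) ==> (t \in O)]]].

(** What an arrival with preference j does to the set of occupied spots. *)
Definition fill O (j : nat) : {set 'I_n} :=
  if first_missing O j is Some s then s |: O else O.

Lemma first_available_missing c j :
  first_available c j = first_missing (occupied c) j.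
Proof.
apply: eq_pick => s; rewrite inE negbK; congr [&& _, _ & _].
by apply: eq_forallb => t; rewrite inE.
Qed.

Lemma occupied_put c s i : occupied (put c s i) = s |: occupied c.
Proof. by apply/setP=> t; rewrite !inE ffunE; case: (t =P s). Qed.

Lemma occupied_drive c i j : occupied (drive c i j) = fill (occupied c) j.
Proof.
rewrite /drive /fill first_available_missing.
by case: first_missing => // s; rewrite occupied_put.
Qed.

Lemma first_missing_free O s : s \notin O -> first_missing O s = Some s.
Proof.
move=> sNO; rewrite /first_missing; case: pickP => [t|/(_ s)].
  case/and3P=> le_st _ /forallP/(_ s); rewrite leqnn (negPf sNO) implybF -leqNgt.
  by move=> le_ts; congr Some; apply/val_inj/anti_leq; rewrite le_st andbT.
rewrite leqnn sNO => /negbT/forallPn[t].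
by rewrite negb_imply => /andP[/andP[/leq_ltn_trans lt /lt]]; rewrite ltnn.
Qed.

Lemma fill_occupied O s : s \in O -> fill O s = fill O s.+1.
Proof.
move=> sO; rewrite /fill; congr (if _ is Some t then t |: O else O).
apply: eq_pick => t; have [-> | ne_ts] := eqVneq t s.
  by rewrite sO /= andbF ltnn.
rewrite [s <= t]leq_eqVlt eq_sym (inj_eq val_inj) (negPf ne_ts) /=.
congr [&& _, _ & _]; apply: eq_forallb => u.
have [-> | ne_us] := eqVneq u s; first by rewrite sO !implybT.
by rewrite [s <= u]leq_eqVlt eq_sym (inj_eq val_inj) (negPf ne_us).
Qed.

Lemma first_missing_past O j : n <= j -> first_missing O j = None.
Proof.
move=> le_nj; rewrite /first_missing; case: pickP => // s /andP[le_js _].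
by have := leq_trans (ltn_ord s) (leq_trans le_nj le_js); rewrite ltnn.
Qed.

(** The new occupied set does not depend on the bump budget b: the bumping car
    takes over the bumped one's spot, which was occupied already, and an
    occupied spot j may be skipped in the search for the first missing one. *)
Lemma occupied_cascade b c i j :
  occupied (cascade b c i j) = fill (occupied c) j.
Proof.
elim: b c i j => [|b IHb] c i j /=; case: insubP => [s _ <-|];
  try by rewrite -leqNgt /fill => /first_missing_past->.
all: case cs: (c s) => [d|];
  last by rewrite occupied_put /fill first_missing_free // inE cs.
  by rewrite occupied_drive.
have s_occ : s \in occupied c by rewrite inE cs.
by rewrite IHb occupied_put (setUidPr _) ?sub1set // -fill_occupied.
Qed.

Lemma cascade0 c i j : cascade 0 c i j = drive c i j.
Proof.
rewrite /= /drive first_available_missing; case: insubP => [s _ <-|].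
  by case cs: (c s) => [d|] //; rewrite first_missing_free // inE cs.
by rewrite -leqNgt => /first_missing_past->.
Qed.

Definition fill_all (alpha : n.-tuple 'I_n) : {set 'I_n} :=
  foldl (fun O i => fill O (tnth alpha i)) set0 (enum 'I_n).

Lemma occupied_outcome k (alpha : n.-tuple 'I_n) :
  occupied (outcome (@cascading_rule n k) alpha) = fill_all alpha.
Proof.
rewrite /outcome /fill_all.
have <-: occupied (empty_street n) = set0.
  by apply/setP=> s; rewrite !inE ffunE.
elim: (enum _) (empty_street n) => //= i r IHr c.
by rewrite IHr occupied_cascade.
Qed.

Definition single c := {in occupied c &, injective c}.

Definition absent c i := forall s, c s <> Some i.

Lemma single_put c s i : single c -> absent c i -> single (put c s i).
Proof.
move=> c1 ci t u; rewrite !inE !ffunE.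
case: (t =P s) => [->|_]; case: (u =P s) => [->|_] //.
- by move=> _ _ icu; case: (ci u).
- by move=> _ _ cti; case: (ci t).
by move=> t_occ u_occ; apply: c1; rewrite inE.
Qed.

Lemma absent_put c s i x : x <> i -> absent c x -> absent (put c s i) x.
Proof.
by move=> ne_xi cx t; rewrite ffunE; case: eqP => _ // [/esym].
Qed.

(** The bumped car is off the street while it moves on, so it satisfies in its
    turn the hypothesis made on the entering car, and the induction can pass
    from one to the other. The second conclusion says that an entry brings no
    car other than i onto the street: the cars still to come remain outside. *)
Lemma single_cascade b c i j :
  single c -> absent c i ->
  single (cascade b c i j)
  /\ forall x, x <> i -> absent c x -> absent (cascade b c i j) x.
Proof.
have put_ok c' s i' : single c' -> absent c' i' ->
    single (put c' s i')
    /\ forall x, x <> i' -> absent c' x -> absent (put c' s i') x.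
  by move=> c1 ci; split=> [|x]; [apply: single_put | apply: absent_put].
elim: b c i j => [|b IHb] c i j c1 ci.
  by rewrite cascade0 /drive; case: first_available => [s|]; first exact: put_ok.
rewrite /=; case: insubP => [s _ <-|//]; case cs: (c s) => [d|]; last exact: put_ok.
have [put1 putN] := put_ok c s i c1 ci.
have d_absent : absent (put c s i) d.
  move=> t; rewrite ffunE; case: eqP => [_ [eq_id]|ne_ts ct].
    by case: (ci s); rewrite cs eq_id.
  by case: ne_ts; apply: c1; rewrite ?inE ?cs ?ct.
have [res1 resN] := IHb _ _ s.+1 put1 d_absent; split=> // x ne_xi cx.
apply: resN; last exact: putN.
by move=> eq_xd; case: (cx s); rewrite cs eq_xd.
Qed.

Lemma single_outcome k (alpha : n.-tuple 'I_n) :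
  single (outcome (@cascading_rule n k) alpha).
Proof.
rewrite /outcome.
have: single (empty_street n) by move=> s t; rewrite inE ffunE.
have: {in enum 'I_n, forall i, absent (empty_street n) i}.
  by move=> i _ s; rewrite ffunE.
elim: (enum _) (enum_uniq 'I_n) (empty_street n) => //= i r IHr.
case/andP=> iNr r_uniq c c_absent c1.
have [res1 resN] := single_cascade k (tnth alpha i) c1 (c_absent i (mem_head i r)).
apply: IHr => // x xr; apply: resN; last by apply: c_absent; rewrite inE xr orbT.
by move=> eq_xi; rewrite -eq_xi xr in iNr.
Qed.

(** The cars standing on the street form the image of the occupied set under c,
    which has as many elements as that set because no car stands twice; as
    there are n cars and n spots, one of the two sets is full exactly when the
    other is. *)
Lemma all_parked_full c : single c -> all_parked c = (occupied c == setT).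
Proof.
move=> c1; have card_cars : #|[set Some i | i : 'I_n]| = n.
  by rewrite card_imset ?card_ord // => i j [].
have image_cars : c @: occupied c \subset [set Some i | i : 'I_n].
  apply/subsetP=> _ /imsetP[s s_occ ->]; move: s_occ; rewrite inE.
  by case: (c s) => // i _; apply: imset_f.
have -> : all_parked c = ([set Some i | i : 'I_n] \subset c @: occupied c).
  apply/forallP/subsetP=> [parked _ /imsetP[i _ ->]|cars i].
    have /existsP[s /eqP cs] := parked i.
    by apply/imsetP; exists s; rewrite ?inE cs.
  have /imsetP[s _ cs] : Some i \in c @: occupied c by apply/cars/imset_f.
  by apply/existsP; exists s; rewrite -cs.
rewrite eqEcard subsetT cardsT card_ord /= -(card_in_imset c1).
have := geq_leqif (subset_leqif_cards image_cars).
by rewrite card_cars eqEsubset image_cars => ->.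
Qed.

End Street.

Theorem theorem1 (n : nat) (hn : 1 <= n) (k : nat) : PF n = CPF n k.
Proof.
have outcome0 alpha :
    outcome (@classical_rule n) alpha = outcome (@cascading_rule n 0) alpha.
  rewrite /outcome; elim: (enum _) (empty_street n) => //= i r IHr c.
  by rewrite IHr /cascading_rule cascade0.
apply/setP=> alpha; rewrite !inE outcome0.
by rewrite !all_parked_full ?occupied_outcome //; apply: single_outcome.
Qed.
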